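(* Let $\mathbb{F}\in\{\mathbb{R},\mathbb{C}\}$, let $N\ge2$, $M\ge2$ and $Q$ be integers with $1\le Q\le M-1$, write $\mathcal{M}=\{1,\dots,M\}$, and let $\mathbf{H}_1,\dots,\mathbf{H}_M$ be $N\times N$ positive semidefinite matrices (real symmetric if $\mathbb{F}=\mathbb{R}$, Hermitian if $\mathbb{F}=\mathbb{C}$). Take $\epsilon=0$. Let $v^{\min}_{\rm QP}$ be the optimal value of (P1): minimize $\|\mathbf{w}\|^2$ over $\mathbf{w}\in\mathbb{F}^N$, $\boldsymbol\beta\in\{0,1\}^M$ subject to $\mathbf{w}^H\mathbf{H}_i\mathbf{w}\ge\beta_i$ ($i\in\mathcal{M}$) and $\sum_i\beta_i=Q$; and let $v^{\min}_{\rm SDP2}$ be the optimal value of (SDP2): minimize $\mathrm{Tr}[\mathbf{X}]$ over $N\times N$ matrices $\mathbf{X}\succeq0$ (real symmetric if $\mathbb{F}=\mathbb{R}$, Hermitian if $\mathbb{F}=\mathbb{C}$) and $\boldsymbol\beta\in\mathbb{R}^M$ subject to $\mathrm{Tr}[\mathbf{H}_i\mathbf{X}]\ge\beta_i$ ($i\in\mathcal{M}$), $\sum_i\beta_i=Q$, $0\le\beta_i\le1$. Then $$v^{\min}_{\rm QP}\le\frac{27Q^2(M-Q+1)}{\pi}\,v^{\min}_{\rm SDP2}\quad\text{when }\mathbb{F}=\mathbb{R},$$ and $$v^{\min}_{\rm QP}\le\max\{8Q,\ 24(\sqrt{Q}-1)^2\}\,(M-Q+1)\,v^{\min}_{\rm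 SDP2}\quad\text{when }\mathbb{F}=\mathbb{C}.$$
   Context: ${}^H$ denotes conjugate transpose (ordinary transpose in the real case). *)

(* Defs.v *)
From HB Require Import structures.
From mathcomp Require Import all_boot all_order all_algebra.
From mathcomp Require Import all_classical all_reals.
From mathcomp Require Import ereal trigo.
From mathcomp Require Import complex.
Set Implicit Arguments. Unset Strict Implicit. Unset Printing Implicit Defensive.
Import Order.TTheory GRing.Theory Num.Theory.
Local Open Scope ring_scope.

(* Generic over a scalar field F (R or C = R[i]), with a conjugation [cj]
   (identity for R, complex conjugation for C) and the embedding [emb] of the
   reals R into F (identity for R, r |-> r%:C for C). *)

Definition adjmx (F : numFieldType) (cj : F -> F) (m n : nat) (A : 'M[F]_(m, n))
  : 'M[F]_(n, m) := (map_mx cj A)^T.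

Definition hermmx (F : numFieldType) (cj : F -> F) (n : nat) (A : 'M[F]_n) :=
  adjmx cj A = A.

Definition psdmx (F : numFieldType) (cj : F -> F) (n : nat) (A : 'M[F]_n) :=
  hermmx cj A /\ forall v : 'cV[F]_n, 0 <= (adjmx cj v *m A *m v) 0 0.

Definition P1_feasible (F : numFieldType) (cj : F -> F) (N M Q : nat)
  (H : 'I_M -> 'M[F]_N) (w : 'cV[F]_N) (beta : 'I_M -> bool) :=
  (forall i, (beta i)%:R <= (adjmx cj w *m H i *m w) 0 0) /\
  (\sum_(i < M) (beta i : nat))%N = Q.

(* optimal value of (P1): inf of ||w||^2 over feasible points (+oo if none) *)
Definition vQP (R : realType) (F : numFieldType) (emb : R -> F) (cj : F -> F)
  (N M Q : nat) (H : 'I_M -> 'M[F]_N) : \bar R :=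
  ereal_inf (EFin @` [set r : R | exists w beta,
     P1_feasible cj Q H w beta /\ emb r = (adjmx cj w *m w) 0 0]).

Definition SDP2_feasible (R : realType) (F : numFieldType) (emb : R -> F)
  (cj : F -> F) (N M Q : nat) (H : 'I_M -> 'M[F]_N) (X : 'M[F]_N)
  (beta : 'I_M -> R) :=
  psdmx cj X /\
  (forall i, emb (beta i) <= \tr (H i *m X)) /\
  \sum_(i < M) beta i = Q%:R /\
  (forall i, 0 <= beta i <= 1).

(* optimal value of (SDP2): inf of Tr[X] over feasible points (+oo if none) *)
Definition vSDP2 (R : realType) (F : numFieldType) (emb : R -> F) (cj : F -> F)
  (N M Q : nat) (H : 'I_M -> 'M[F]_N) : \bar R :=
  ereal_inf (EFin @` [set r : R | exists X beta,
     SDP2_feasible emb cj Q H X beta /\ emb r = \tr X]).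

Definition cplx_emb (R : realType) (r : R) : R[i] := (r%:C)%C.

(* Main.v *)
Require Import Defs.
From HB Require Import structures.
From mathcomp Require Import all_boot all_order all_algebra.
From mathcomp Require Import all_classical all_reals.
From mathcomp Require Import ereal sequences trigo exp.
From mathcomp Require Import measure measurable_realfun lebesgue_measure lebesgue_integral.
From mathcomp Require Import normal_distribution.
From mathcomp Require Import ring lra.
From mathcomp Require Import complex.
Set Implicit Arguments. Unset Strict Implicit. Unset Printing Implicit Defensive.
Import Order.TTheory GRing.Theory Num.Theory.
Local Open Scope ring_scope.

(** Let [(X, beta)] be feasible for (SDP2). Since the [beta i] lie in [[0, 1]]
    and sum to [Q], at least [Q] of them are at least [1 / (M - Q + 1)]; let [S]
    consist of [Q] such indices. Write [X] as a sum of rank-one matrices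
    [x x^H] and let [w] be the corresponding Gaussian combination of the [x],
    so that the mean of [w^H G w] is a multiple of [Tr (G X)]. It suffices to
    find one [w] with [|w|^2 < C Tr X * w^H H_i w] for all [i] in [S], and for
    this that the mean of

      [exp (- |w|^2 / (2 Tr X)) - \sum_(i in S) exp (- C / 2 * w^H H_i w)]

    is positive. These means are [det (1 + 2 G) ^ (-1/2)] (to the power [-1]
    over the complex numbers), where [1 + 2 tr G <= det (1 + 2 G) <= exp (2 tr G)],
    so any [C] somewhat above [e Q^2 (M - Q + 1)] (resp. [e Q (M - Q + 1)])
    will do. No integral in several variables is needed: the coordinates of
    [w] are integrated out, hence also chosen, one at a time. *)

(** * Gaussian integrals in one variable *)

Lemma le_normal_pdf_mixture (R : realType) (I : finType) (k0 m0 s0 : R)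
    (k m s : I -> R) :
  0 <= k0 -> (forall i, 0 <= k i) ->
  (forall x, k0 * normal_pdf m0 s0 x <= \sum_i k i * normal_pdf (m i) (s i) x) ->
  k0 <= \sum_i k i.
Proof.
move=> k00 k_ge0 le_pdf; rewrite -lee_fin -sumEFin.
have mpdf m' s' (c : R) : measurable_fun setT
    (fun x => c%:E * (normal_pdf m' s' x)%:E)%E.
  apply/measurable_EFinP.
  by apply: measurable_funM => //; exact: measurable_normal_pdf.
have int_pdf m' s' (c : R) : 0 <= c ->
    (\int[lebesgue_measure]_x (c%:E * (normal_pdf m' s' x)%:E) = c%:E)%E.
  move=> c0; rewrite ge0_integralZl//.
  - by rewrite integral_normal_pdf mule1.
  - by apply/measurable_EFinP; exact: measurable_normal_pdf.
  - by move=> x _; rewrite lee_fin normal_pdf_ge0.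
have pdf_ge0 m' s' (c : R) x : 0 <= c -> (0 <= c%:E * (normal_pdf m' s' x)%:E)%E.
  by move=> c0; rewrite -EFinM lee_fin mulr_ge0// normal_pdf_ge0.
(* A normal density has mass 1, so each weight is the integral of its weighted density. *)
rewrite -(int_pdf m0 s0)//.
under eq_bigr => i _ do rewrite -(int_pdf (m i) (s i))//.
rewrite -ge0_integral_sum//; first last.
- by move=> i x _; exact: pdf_ge0.
- by move=> i; exact: mpdf.
apply: ge0_le_integral => //.
- by move=> x _; exact: pdf_ge0.
- exact: mpdf.
- by apply: emeasurable_sum => i; exact: mpdf.
- by move=> x _; under eq_bigr do rewrite -EFinM; rewrite sumEFin lee_fin.
Qed.

(** Completing the square: the total exponent is [2 * b ^+ 2 / (1 + 2 * a)] minus [(1 + 2 * a) / 2]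
    times the square of [x + 2 * b / (1 + 2 * a)]. The constant in front of the density is thus the
    integral over [x]. *)
Lemma gauss_pdfE (R : realType) (a b x : R) : 0 <= a ->
  expR (- (a * x ^+ 2 + 2 * b * x)) * expR (- (x ^+ 2 / 2)) =
  Num.sqrt (pi *+ 2) * (expR (2 * b ^+ 2 / (1 + 2 * a)) / Num.sqrt (1 + 2 * a))
  * normal_pdf (- (2 * b / (1 + 2 * a))) (Num.sqrt (1 + 2 * a))^-1 x.
Proof.
move=> a0; have da0 : 0 < 1 + 2 * a by lra.
have sq0 : Num.sqrt (1 + 2 * a) != 0 by rewrite gt_eqF// sqrtr_gt0.
rewrite normal_pdfE ?invr_eq0// /normal_peak /normal_fun exprVn sqr_sqrtr ?ltW//.
rewrite -mulrnAr sqrtrM ?invr_ge0 ?ltW// sqrtrV ?ltW//.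
have p0 : Num.sqrt (pi *+ 2 : R) != 0.
  by rewrite gt_eqF// sqrtr_gt0 mulrn_wgt0// pi_gt0.
rewrite [RHS](_ : _ = expR (2 * b ^+ 2 / (1 + 2 * a)) *
  expR (- (x - - (2 * b / (1 + 2 * a))) ^+ 2 / ((1 + 2 * a)^-1 *+ 2))); last first.
  by field; rewrite sq0 p0.
by rewrite -!expRD; congr expR; field; rewrite gt_eqF.
Qed.

(* Both sides are integrated against the standard Gaussian weight; if the
   conclusion failed for every [x], so would the hypothesis. *)
Lemma gauss_coordinate_exists (R : realType) (I : finType) (k0 a0 b0 : R)
    (k a b : I -> R) :
  0 <= k0 -> 0 <= a0 -> (forall i, 0 <= k i) -> (forall i, 0 <= a i) ->
  \sum_i k i * (expR (2 * b i ^+ 2 / (1 + 2 * a i)) / Num.sqrt (1 + 2 * a i)) <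
  k0 * (expR (2 * b0 ^+ 2 / (1 + 2 * a0)) / Num.sqrt (1 + 2 * a0)) ->
  exists x, \sum_i k i * expR (- (a i * x ^+ 2 + 2 * b i * x)) <
            k0 * expR (- (a0 * x ^+ 2 + 2 * b0 * x)).
Proof.
move=> k00 a00 k_ge0 a_ge0 lt_int; apply: contrapT => /forallNP noex.
move: lt_int; apply/negP; rewrite -leNgt.
apply: (@le_normal_pdf_mixture _ _ _ (- (2 * b0 / (1 + 2 * a0)))
  (Num.sqrt (1 + 2 * a0))^-1 _ (fun i => - (2 * b i / (1 + 2 * a i)))
  (fun i => (Num.sqrt (1 + 2 * a i))^-1)).
- by rewrite mulr_ge0// divr_ge0 ?expR_ge0// sqrtr_ge0.
- by move=> i; rewrite mulr_ge0// divr_ge0 ?expR_ge0// sqrtr_ge0.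
move=> x; have p0 : 0 < Num.sqrt (pi *+ 2 : R).
  by rewrite sqrtr_gt0 mulrn_wgt0// pi_gt0.
have weightE c a' b' : 0 <= a' -> Num.sqrt (pi *+ 2) *
    (c * (expR (2 * b' ^+ 2 / (1 + 2 * a')) / Num.sqrt (1 + 2 * a')) *
     normal_pdf (- (2 * b' / (1 + 2 * a'))) (Num.sqrt (1 + 2 * a'))^-1 x) =
    c * expR (- (a' * x ^+ 2 + 2 * b' * x)) * expR (- (x ^+ 2 / 2)).
  by move=> a'0; rewrite -[RHS]mulrA (gauss_pdfE b' x a'0); ring.
rewrite -(ler_pM2l p0) mulr_sumr (weightE k0 a0 b0)//.
under eq_bigr => i _ do rewrite (weightE (k i) (a i) (b i))//.
by rewrite -mulr_suml ler_pM2r ?expR_gt0// leNgt; apply/negP.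
Qed.

(** * Positive semidefinite real forms and Gaussian means of their exponentials *)

Section PsdForms.
Context {R : realType} {V : zmodType} (sc : R -> V -> V).
Implicit Types (h : V -> V -> R) (x v w : V) (xs : seq V).

(** Linearity is asked of [h] alone, with [sc] any map, so that complex columns scaled by embedded
    reals are covered too. *)
Definition psd_form h :=
  [/\ forall v w, h v w = h w v,
      forall u v w, h (u + v) w = h u w + h v w,
      forall a v w, h (sc a v) w = a * h v w
    & forall v, 0 <= h v v].

Lemma psd_form0 h w : psd_form h -> h 0 w = 0.
Proof. by case=> _ hD _ _; rewrite -(addrK (h 0 w) (h 0 w)) -hD addr0 subrr. Qed.

Lemma psd_formN h : psd_form h -> forall v w, h (- v) w = - h v w.
Proof.
move=> hP v w; have [_ hD _ _] := hP.
by apply/eqP; rewrite -addr_eq0 -hD addNr psd_form0.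
Qed.

Lemma psd_form_line h x w a : psd_form h ->
  h (sc a x + w) (sc a x + w) = h x x * a ^+ 2 + 2 * h x w * a + h w w.
Proof.
case=> hC hD hZ _; rewrite hD hZ (hC x) (hC w) !hD !hZ (hC w x); ring.
Qed.

Lemma psd_form_Cauchy h x w : psd_form h -> h x w ^+ 2 <= h x x * h w w.
Proof.
move=> hP; have [_ _ _ h_ge0] := hP.
have [x0|x0] := eqVneq (h x x) 0; last first.
  have xx : 0 < h x x by rewrite lt_neqAle eq_sym x0 h_ge0.
  have := h_ge0 (sc (- (h x w / h x x)) x + w); rewrite psd_form_line//.
  rewrite [X in 0 <= X](_ : _ = (h x x * h w w - h x w ^+ 2) / h x x); last by field.
  by rewrite pmulr_lge0 ?invr_gt0// subr_ge0.
have [->|xw] := eqVneq (h x w) 0; first by rewrite expr0n mulr_ge0.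
(* With [h x x = 0] the form is affine along this line; the coefficient is chosen to give it the
   value -1. *)
have := h_ge0 (sc (- (h w w + 1) / (2 * h x w)) x + w); rewrite psd_form_line// x0.
rewrite [X in 0 <= X](_ : _ = -1); last by field.
by rewrite ler0N1.
Qed.

(* The form left in the exponent once the Gaussian coordinate along [x] has
   been integrated out. *)
Definition form_marginal h x v w := h v w - 2 / (1 + 2 * h x x) * (h x v * h x w).

(** By Cauchy-Schwarz the subtracted [2 * h x v ^+ 2] is at most [2 * h x x * h v v], which the
    factor [1 + 2 * h x x] absorbs. *)
Lemma psd_form_marginal h x : psd_form h -> psd_form (form_marginal h x).
Proof.
move=> hP; have [hC hD hZ h_ge0] := hP; rewrite /form_marginal; split.
- by move=> v w; rewrite hC (mulrC (h x v)).
- by move=> u v w; rewrite hD (hC x (u + v)) hD !(hC _ x); ring.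
- by move=> a v w; rewrite hZ (hC x (sc a v)) hZ (hC v x); ring.
move=> v; have := psd_form_Cauchy x v hP; have := h_ge0 x; have := h_ge0 v.
move=> v0 x0 vx; have d0 : 0 < 1 + 2 * h x x by lra.
rewrite -(pmulr_rge0 _ d0).
rewrite [X in 0 <= X](_ : _ = (1 + 2 * h x x) * h v v - 2 * h x v ^+ 2); first nra.
by field; rewrite gt_eqF.
Qed.

(* [det (1 + 2 G)] for the Gram matrix [G] of [xs], by successive Schur complements. *)
Fixpoint gram_det h xs : R :=
  if xs is x :: xs' then (1 + 2 * h x x) * gram_det (form_marginal h x) xs' else 1.

Lemma gram_det_gt0 h xs : psd_form h -> 0 < gram_det h xs.
Proof.
elim: xs h => [|x xs IH] h hP//=; have [_ _ _ h_ge0] := hP.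
have := h_ge0 x => x0; rewrite mulr_gt0//; first by lra.
exact/IH/psd_form_marginal.
Qed.

(** The hypothesis compares the Gaussian means of the two sides. By induction the tail of [xs] gives
    a [w'] for the marginal forms, with the factors [1 / sqrt (1 + 2 * h x x)] moved into the
    weights; the coordinate along [x] is chosen afterwards, with [w'] fixed. *)
Lemma gauss_exists (I : finType) (xs : seq V) (h0 : V -> V -> R)
    (h : I -> V -> V -> R) (c0 : R) (c : I -> R) :
  psd_form h0 -> (forall i, psd_form (h i)) -> 0 <= c0 -> (forall i, 0 <= c i) ->
  \sum_i c i / Num.sqrt (gram_det (h i) xs) < c0 / Num.sqrt (gram_det h0 xs) ->
  exists w, \sum_i c i * expR (- h i w w) < c0 * expR (- h0 w w).
Proof.
elim: xs h0 h c0 c => [|x xs IH] h0 h c0 c h0P hP c00 c_ge0 /=.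
  rewrite sqrtr1 divr1; under eq_bigr do rewrite divr1.
  move=> lt_c; exists 0; rewrite psd_form0// oppr0 expR0 mulr1.
  by under eq_bigr do rewrite psd_form0// oppr0 expR0 mulr1.
have sqrtP h' : psd_form h' -> 0 <= h' x x /\ 0 <= 1 + 2 * h' x x.
  by case=> _ _ _ /(_ x); split=> //; lra.
move=> lt_int.
have [|||||w'] := IH (form_marginal h0 x) (fun i => form_marginal (h i) x)
  (c0 / Num.sqrt (1 + 2 * h0 x x)) (fun i => c i / Num.sqrt (1 + 2 * h i x x)).
- exact: psd_form_marginal.
- by move=> i; exact: psd_form_marginal.
- by rewrite divr_ge0// sqrtr_ge0.
- by move=> i; rewrite divr_ge0// sqrtr_ge0.
- under eq_bigr => i _ do rewrite -mulrA -invfM -sqrtrM ?(sqrtP _ (hP i)).2//.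
  by rewrite -mulrA -invfM -sqrtrM ?(sqrtP _ h0P).2.
have expE c' h' : psd_form h' -> c' / Num.sqrt (1 + 2 * h' x x) *
    expR (- form_marginal h' x w' w') = c' * expR (- h' w' w') *
    (expR (2 * h' x w' ^+ 2 / (1 + 2 * h' x x)) / Num.sqrt (1 + 2 * h' x x)).
  move=> h'P; rewrite -[in RHS]mulrA [expR _ * (_ / _)]mulrA -expRD.
  rewrite mulrAC -mulrA; congr (_ * (expR _ / _)); rewrite /form_marginal; ring.
rewrite expE//; under eq_bigr do rewrite expE//.
case/gauss_coordinate_exists => [||||a lt_a].
- by rewrite mulr_ge0// expR_ge0.
- by have [] := sqrtP _ h0P.
- by move=> i; rewrite mulr_ge0// expR_ge0.
- by move=> i; have [] := sqrtP _ (hP i).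
exists (sc a x + w'); rewrite psd_form_line//.
have lineE h' : expR (- (h' x x * a ^+ 2 + 2 * h' x w' * a + h' w' w')) =
    expR (- h' w' w') * expR (- (h' x x * a ^+ 2 + 2 * h' x w' * a)).
  by rewrite -expRD; congr expR; ring.
under eq_bigr do rewrite psd_form_line// lineE mulrA.
by rewrite lineE mulrA.
Qed.

Lemma form_marginal_le h x v : psd_form h -> form_marginal h x v v <= h v v.
Proof.
case=> _ _ _ /(_ x) x0; rewrite /form_marginal gerBl mulr_ge0//.
  by rewrite divr_ge0//; lra.
by rewrite -expr2 sqr_ge0.
Qed.

(** Each factor satisfies [1 + a <= expR a], and passing to a marginal only lowers the diagonal. *)
Lemma gram_det_le_expR h xs :
  psd_form h -> gram_det h xs <= expR (2 * \sum_(x <- xs) h x x).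
Proof.
elim: xs h => [|x xs IH] h hP /=; first by rewrite big_nil mulr0 expR0.
have [_ _ _ h_ge0] := hP; have := h_ge0 x => x0.
rewrite big_cons mulrDr expRD ler_pM//; first by lra.
- exact/ltW/gram_det_gt0/psd_form_marginal.
- exact: expR_ge1Dx.
apply: le_trans (IH _ (psd_form_marginal x hP)) _.
rewrite ler_expR ler_pM2l//; apply: ler_sum => y _; exact: form_marginal_le.
Qed.

(** Cauchy-Schwarz bounds each [h y y] by [1 + 2 * h x x] times its marginal. This is the inductive
    step of the trace bound on the determinant. *)
Lemma form_marginal_trace_ge h x xs : psd_form h ->
  1 + 2 * \sum_(y <- x :: xs) h y y <=
  (1 + 2 * h x x) * (1 + 2 * \sum_(y <- xs) form_marginal h x y y).
Proof.
move=> hP; have [_ _ _ h_ge0] := hP; have := h_ge0 x => x0.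
have d0 : 0 < 1 + 2 * h x x by lra.
suff : \sum_(y <- xs) h y y <=
    (1 + 2 * h x x) * \sum_(y <- xs) form_marginal h x y y by rewrite big_cons; lra.
rewrite mulr_sumr; apply: ler_sum => y _.
have := psd_form_Cauchy x y hP.
rewrite [X in _ -> _ <= X](_ : _ = (1 + 2 * h x x) * h y y - 2 * h x y ^+ 2); first lra.
by rewrite /form_marginal; field; rewrite gt_eqF.
Qed.

Lemma gram_det_ge_trace h xs :
  psd_form h -> 1 + 2 * \sum_(x <- xs) h x x <= gram_det h xs.
Proof.
elim: xs h => [|x xs IH] h hP /=; first by rewrite big_nil mulr0 addr0.
apply: le_trans (form_marginal_trace_ge x xs hP) _.
have [_ _ _ /(_ x) x0] := hP; rewrite ler_pM2l; last by lra.
exact/IH/psd_form_marginal.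
Qed.

(** * Forms invariant under multiplication by the imaginary unit *)

Section ComplexStructure.
Variable J : V -> V.
Hypothesis JJ : forall v, J (J v) = - v.

Definition J_invariant h := forall v w, h (J v) (J w) = h v w.

(** A complex Gaussian coordinate along [x] amounts to two real ones, along [x] and [J x]. *)
Definition J_closure xs := flatten [seq [:: x; J x] | x <- xs].

Lemma J_invariant_orth h x : psd_form h -> J_invariant h -> h x (J x) = 0.
Proof.
move=> hP hJ; have [hC _ _ _] := hP.
by have := hJ x (J x); rewrite JJ hC psd_formN// (hC x (J x)); lra.
Qed.

Lemma J_invariant_Cauchy h x y : psd_form h -> J_invariant h ->
  h x y ^+ 2 + h (J x) y ^+ 2 <= h x x * h y y.
Proof.
move=> hP hJ; have [hC hD hZ h_ge0] := hP.
set s := _ + _; have s_ge0 : 0 <= s by rewrite addr_ge0// sqr_ge0.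
(* The combination of [x] and [J x] with coefficients [h x y] and [h (J x) y] has product [s] with
   [y] and square [s * h x x]; the claim is then Cauchy-Schwarz divided by [s]. *)
have := psd_form_Cauchy (sc (h x y) x + sc (h (J x) y) (J x)) y hP.
rewrite psd_form_line// (hC x (sc _ _)) !hD !hZ (hC _ (sc _ _)) !hZ hJ.
rewrite (hC (J x) x) J_invariant_orth//.
rewrite [X in X ^+ 2 <= _](_ : _ = s); last by rewrite /s; ring.
rewrite [leRHS](_ : _ = s * (h x x * h y y)); last by rewrite /s; ring.
move: s_ge0; rewrite le_eqVlt => /predU1P[<- _|s0]; first exact: mulr_ge0.
by rewrite expr2 ler_pM2l.
Qed.

Lemma form_marginal2E h x v w : psd_form h -> J_invariant h ->
  form_marginal (form_marginal h x) (J x) v w =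
  h v w - 2 / (1 + 2 * h x x) * (h x v * h x w + h (J x) v * h (J x) w).
Proof.
move=> hP hJ; rewrite /form_marginal J_invariant_orth// hJ !mul0r !mulr0 !subr0; ring.
Qed.

(** A marginal along [x] alone generally breaks invariance, so the induction must remove [x] and
    [J x] together. *)
Lemma J_invariant_marginal2 h x : psd_form h -> J_invariant h ->
  J_invariant (form_marginal (form_marginal h x) (J x)).
Proof.
move=> hP hJ v w; have [hC _ _ _] := hP; rewrite !form_marginal2E// !hJ.
have swap u : h x (J u) = - h (J x) u.
  by rewrite -hJ JJ hC psd_formN// hC.
by rewrite !swap; ring.
Qed.

(* Both coordinates of a complex direction have the same variance, so each
   eigenvalue of the Gram matrix occurs twice. *)
Lemma gram_det_J_closure_ge h xs : psd_form h -> J_invariant h ->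
  (1 + 2 * \sum_(x <- xs) h x x) ^+ 2 <= gram_det h (J_closure xs).
Proof.
elim: xs h => [|x xs IH] h hP hJ /=; first by rewrite big_nil mulr0 addr0 expr1n.
have [_ _ _ h_ge0] := hP; have := h_ge0 x => x0.
have d0 : 0 < 1 + 2 * h x x by lra.
have -> : form_marginal h x (J x) (J x) = h x x.
  by rewrite /form_marginal hJ J_invariant_orth// mulr0 mulr0 subr0.
have mP : psd_form (form_marginal (form_marginal h x) (J x)).
  exact/psd_form_marginal/psd_form_marginal.
rewrite mulrA -expr2; apply: (@le_trans _ _ ((1 + 2 * h x x) ^+ 2 *
    (1 + 2 * \sum_(y <- xs) form_marginal (form_marginal h x) (J x) y y) ^+ 2));
  last by rewrite ler_pM2l ?exprn_gt0//; apply: IH => //; exact: J_invariant_marginal2.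
have S0 : 0 <= \sum_(y <- xs) form_marginal (form_marginal h x) (J x) y y.
  by apply: sumr_ge0 => y _; have [_ _ _] := mP; exact.
rewrite -exprMn lerXn2r ?nnegrE//.
- by rewrite addr_ge0// mulr_ge0// sumr_ge0.
- by rewrite mulr_ge0//; lra.
suff : \sum_(y <- xs) h y y <= (1 + 2 * h x x) *
    \sum_(y <- xs) form_marginal (form_marginal h x) (J x) y y.
  by rewrite big_cons; lra.
rewrite mulr_sumr; apply: ler_sum => y _; rewrite form_marginal2E//.
have := J_invariant_Cauchy x y hP hJ.
rewrite [X in _ -> _ <= X](_ : _ =
  (1 + 2 * h x x) * h y y - 2 * (h x y ^+ 2 + h (J x) y ^+ 2)); first lra.
by field; rewrite gt_eqF.
Qed.

End ComplexStructure.
End PsdForms.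

(** * Positive semidefinite matrices as sums of rank-one matrices *)

Section RankOneDecomposition.
Context {F : numFieldType} (cj : {rmorphism F -> F}).
Hypotheses (cjK : involutive cj)
  (cj_sqrt : forall a : F, 0 <= a -> exists s, s * cj s = a).
Local Notation adj := (adjmx cj).

Lemma adjmxD m n (A B : 'M[F]_(m, n)) : adj (A + B) = adj A + adj B.
Proof. by rewrite /adjmx map_mxD linearD. Qed.

Lemma adjmxZ m n a (A : 'M[F]_(m, n)) : adj (a *: A) = cj a *: adj A.
Proof. by rewrite /adjmx map_mxZ linearZ. Qed.

Lemma adjmxM m n p (A : 'M[F]_(m, n)) (B : 'M[F]_(n, p)) :
  adj (A *m B) = adj B *m adj A.
Proof. by rewrite /adjmx map_mxM trmx_mul. Qed.

Lemma adjmxK m n (A : 'M[F]_(m, n)) : adj (adj A) = A.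
Proof. by apply/matrixP => i j; rewrite !mxE cjK. Qed.

Lemma adjmx_delta n (k : 'I_n) : adj (delta_mx k 0 : 'cV[F]_n) = delta_mx 0 k.
Proof. by rewrite /adjmx map_delta_mx trmx_delta. Qed.

Lemma hermmxE n (X : 'M[F]_n) i j : hermmx cj X -> cj (X i j) = X j i.
Proof. by move=> /matrixP /(_ j i); rewrite !mxE. Qed.

Lemma qform_line n (X : 'M[F]_n) k a (u : 'cV[F]_n) : hermmx cj X ->
  let v := a *: delta_mx k 0 + u in let p := (X *m u) k 0 in
  (adj v *m X *m v) 0 0 =
  a * cj a * X k k + cj a * p + a * cj p + (adj u *m X *m u) 0 0.
Proof.
move=> Xh v p; set e : 'cV[F]_n := delta_mx k 0.
have mulEl (A : 'cV[F]_n) : (adj e *m A) 0 0 = A k 0.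
  by rewrite adjmx_delta -rowE mxE.
have mulEr (A : 'rV[F]_n) : (A *m e) 0 0 = A 0 k.
  by rewrite -colE mxE.
have pE : (adj e *m X *m u) 0 0 = p by rewrite -mulmxA mulEl.
have cjpE : (adj u *m X *m e) 0 0 = cj p.
  by rewrite mulEr -{1}Xh -adjmxM 2!mxE.
have eE : (adj e *m X *m e) 0 0 = X k k by rewrite -mulmxA mulEl -colE mxE.
rewrite /v adjmxD adjmxZ !(mulmxDl, mulmxDr) -!(scalemxAl, scalemxAr).
have addE (A B : 'M[F]_1) : (A + B) 0 0 = A 0 0 + B 0 0 by rewrite mxE.
have scaleE b (A : 'M[F]_1) : (b *: A) 0 0 = b * A 0 0 by rewrite mxE.
by rewrite !(addE, scaleE) -/e pE cjpE eE; ring.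
Qed.

Lemma psdmx_diag_ge0 n (X : 'M[F]_n) k : psdmx cj X -> 0 <= X k k.
Proof.
case=> Xh /(_ (1 *: delta_mx k 0 + 0)); rewrite qform_line//.
by rewrite !mulmx0 !mxE !rmorph0 !rmorph1 !mulr0 !addr0 !mul1r.
Qed.

Lemma psdmx_diag_eq0 n (X : 'M[F]_n) k j : psdmx cj X -> X k k = 0 -> X k j = 0.
Proof.
move=> XP Xk0; have [Xh X_ge0] := XP; apply/eqP/contraT => Xkj.
set p := X k j * cj (X k j).
have p0 : p != 0 by rewrite mulf_neq0// fmorph_eq0.
set t := (X j j + 1) / (2 * p).
have cjt : cj t = t.
  rewrite /t fmorph_div rmorphD rmorph1 rmorphM rmorph_nat hermmxE//.
  by rewrite /p rmorphM cjK (mulrC (X k j)).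
(* Here the form takes the value [X j j - 2 * t * p], and [t] makes it -1. *)
have := X_ge0 ((- (t * X k j)) *: delta_mx k 0 + delta_mx j 0); rewrite qform_line//.
have -> : (X *m (delta_mx j 0 : 'cV[F]_n)) k 0 = X k j by rewrite -colE mxE.
have -> : (adj (delta_mx j 0 : 'cV[F]_n) *m X *m (delta_mx j 0 : 'cV[F]_n)) 0 0 = X j j.
  by rewrite adjmx_delta -rowE -colE !mxE.
rewrite Xk0 rmorphN rmorphM cjt.
rewrite [X in 0 <= X](_ : _ = -1); first by rewrite ler0N1.
suff -> : X j j = 2 * t * p - 1 by rewrite /p; ring.
by rewrite /t; field.
Qed.

(** The Schur complement at [u] equals the form of [X] at [u] shifted along the [k]-th basis vector
    by [- (p / X k k)], the shift that completes the square. *)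
Lemma psdmx_schur n (X : 'M[F]_n) k : psdmx cj X -> X k k != 0 ->
  psdmx cj (X - (X k k)^-1 *: (col k X *m adj (col k X))).
Proof.
move=> [Xh X_ge0] d0.
have cjd : cj (X k k)^-1 = (X k k)^-1 by rewrite fmorphV hermmxE.
split.
  rewrite /hermmx -scaleN1r adjmxD adjmxZ Xh rmorphN1 adjmxZ cjd.
  by rewrite adjmxM adjmxK scaleN1r.
move=> u; set p := (X *m u) k 0.
have cp : (adj (col k X) *m u) 0 0 = p.
  by rewrite /p !mxE; apply: eq_bigr => j _; rewrite !mxE hermmxE.
have := X_ge0 ((- (p / X k k)) *: delta_mx k 0 + u); rewrite qform_line// -/p.
suff -> : (adj u *m (X - (X k k)^-1 *: (col k X *m adj (col k X))) *m u) 0 0 =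
    (adj u *m X *m u) 0 0 - (X k k)^-1 * (p * cj p).
  rewrite rmorphN rmorphM cjd => pos.
  rewrite (le_trans pos)// le_eqVlt; apply/orP; left; apply/eqP.
  by field.
have cp' : (adj u *m col k X) 0 0 = cj p.
  by rewrite -cp -{1}(adjmxK (col k X)) -adjmxM 2!mxE.
have -> : (p * cj p) = (adj u *m (col k X *m adj (col k X)) *m u) 0 0.
  rewrite mulmxA -mulmxA [RHS]mxE big_ord1 cp' cp; exact: mulrC.
by rewrite mulmxBr mulmxBl -scalemxAr -scalemxAl !mxE.
Qed.

(** Symmetric elimination, by induction on the number of nonzero diagonal entries. A Schur
    complement clears the pivot, and a zero diagonal entry stays zero because its whole row
    vanishes. *)
Lemma psdmx_rank_one_sum n (X : 'M[F]_n) : psdmx cj X ->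
  exists xs : seq 'cV[F]_n, X = \sum_(x <- xs) x *m adj x.
Proof.
have [r] := ubnP #|[pred k | X k k != 0]|; elim: r X => // r IH X ltr XP.
have [Xh _] := XP.
have [k d0|X0] := pickP [pred k | X k k != 0]; last first.
  exists [::]; rewrite big_nil; apply/matrixP => i j; rewrite mxE.
  by apply: psdmx_diag_eq0 => //; apply/eqP; have /= := X0 i; case: eqP.
rewrite /= in d0; have [s sE] := cj_sqrt (psdmx_diag_ge0 k XP).
have [|xs XE] := IH _ _ (psdmx_schur XP d0); last first.
  exists (s^-1 *: col k X :: xs); rewrite big_cons -XE adjmxZ.
  rewrite -scalemxAl -scalemxAr scalerA.
  by rewrite fmorphV -invfM sE addrC subrK.
rewrite ltnS in ltr; apply: leq_trans ltr; apply: proper_card.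
apply/properP; split; last first.
  exists k; rewrite !inE// negbK !mxE big_ord1 !mxE hermmxE//.
  by rewrite mulrCA mulVf// mulr1 subrr.
apply/fintype.subsetP => j; rewrite !inE; apply: contraNneq => j0.
by rewrite !mxE big_ord1 !mxE (psdmx_diag_eq0 _ XP j0) j0 mul0r mulr0 subr0.
Qed.

Lemma trace_rank_one_sum n (H : 'M[F]_n) (xs : seq 'cV[F]_n) :
  \tr (H *m \sum_(x <- xs) x *m adj x) = \sum_(x <- xs) (adj x *m H *m x) 0 0.
Proof.
rewrite mulmx_sumr raddf_sum /=; apply: eq_bigr => x _.
by rewrite mulmxA mxtrace_mulC mulmxA /mxtrace big_ord1.
Qed.

End RankOneDecomposition.

(** * Rounding: one vector that serves all the forms in [S] *)

Section Rounding.
Context {R : realType} {V : zmodType} {sc : R -> V -> V}.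
Implicit Types (h : V -> V -> R) (xs : seq V).

Lemma psd_formZ h a : psd_form sc h -> 0 <= a -> psd_form sc (fun v w => a * h v w).
Proof.
case=> hC hD hZ h_ge0 a0; split.
- by move=> v w; rewrite hC.
- by move=> u v w; rewrite hD mulrDr.
- by move=> b v w; rewrite hZ mulrCA.
- by move=> v; rewrite mulr_ge0.
Qed.

(** The weights are the indicator of [S]. Every single term of the sum lies below the exponential of
    [h0], and comparing exponents gives [h0 w w < C * t * h i w w]; rescaling [w] does the rest. *)
Lemma form_rounding (I : finType) (S : {set I}) xs h0 (h : I -> V -> V -> R) (C t : R) :
  psd_form sc h0 -> (forall v, h0 v v = 0 -> v = 0) ->
  (forall i, psd_form sc (h i)) -> 0 < C -> 0 < t -> S != finset.set0 ->
  \sum_(i in S) (Num.sqrt (gram_det (fun v w => C / 2 * h i v w) xs))^-1 <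
    (Num.sqrt (gram_det (fun v w => (2 * t)^-1 * h0 v w) xs))^-1 ->
  exists w, h0 w w = C * t /\ forall i, i \in S -> 1 <= h i w w.
Proof.
move=> h0P h0_def hP C0 t0 /set0Pn[i0 Si0] lt_det.
have [_ _ h0Z h0_ge0] := h0P.
have [|||||w lt_w] := @gauss_exists R V sc I xs (fun v w => (2 * t)^-1 * h0 v w)
  (fun i v w => C / 2 * h i v w) 1 (fun i => (i \in S)%:R).
- by apply: psd_formZ => //; rewrite invr_ge0 mulr_ge0// ltW.
- by move=> i; apply: psd_formZ => //; rewrite divr_ge0// ltW.
- exact: ler01.
- by move=> i; exact: ler0n.
- rewrite mul1r; apply: le_lt_trans lt_det; rewrite [leRHS]big_mkcond /=.
  by apply: ler_sum => i _; case: ifP; rewrite ?mul1r ?mul0r.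
have ratio i : i \in S -> h0 w w < C * t * h i w w.
  move=> iS; have : expR (- (C / 2 * h i w w)) < expR (- ((2 * t)^-1 * h0 w w)).
    rewrite mul1r in lt_w; apply: le_lt_trans lt_w; rewrite (bigD1 i)//= iS mul1r.
    by rewrite lerDl sumr_ge0// => j _; rewrite mulr_ge0 ?ler0n ?expR_ge0.
  by rewrite ltr_expR ltrN2 mulrC ltr_pdivrMr ?mulr_gt0//; lra.
(* At [w = 0] the strict inequality for [i0] would read [0 < 0]. *)
have w0 : 0 < h0 w w.
  rewrite lt_neqAle h0_ge0 andbT eq_sym; apply/eqP => /h0_def w0.
  by have := ratio i0 Si0; rewrite w0 !(psd_form0 (sc := sc))// mulr0 ltxx.
set a := Num.sqrt (C * t / h0 w w).
have aE : a ^+ 2 = C * t / h0 w w by rewrite sqr_sqrtr// divr_ge0// mulr_ge0// ltW.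
have sqZ h' : psd_form sc h' -> h' (sc a w) (sc a w) = a ^+ 2 * h' w w.
  by case=> hC _ hZ _; rewrite hZ hC hZ mulrA expr2.
exists (sc a w); split; first by rewrite sqZ// aE divfK// gt_eqF.
move=> i iS; rewrite sqZ// aE mulrAC ler_pdivlMr// mul1r; exact/ltW/ratio.
Qed.

(** If the trace of [h0] vanished, every vector of [xs] would be 0, and so would the trace of [h].
    This allows [t] to be the trace of [h0] below. *)
Lemma trace_gt0 xs h0 h (tau : R) : psd_form sc h0 -> (forall v, h0 v v = 0 -> v = 0) ->
  psd_form sc h -> 0 < tau -> tau <= \sum_(x <- xs) h x x -> 0 < \sum_(x <- xs) h0 x x.
Proof.
move=> [_ _ _ h0_ge0] h0_def hP tau0 tau_le.
rewrite lt_neqAle sumr_ge0 ?andbT//; apply/eqP => /esym/eqP.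
rewrite psumr_eq0// => /allP xs0; move: tau_le; rewrite leNgt => /negP; apply.
rewrite big_seq big1// => x /xs0/eqP/h0_def ->; exact: psd_form0 hP.
Qed.

(** Each of the [#|S|] terms is below [1 / (#|S| * r)], so their sum is below [1 / r], a lower bound
    for the [h0] term. *)
Lemma det_rounding (I : finType) (S : {set I}) xs h0 (h : I -> V -> V -> R) (C t r : R) :
  psd_form sc h0 -> (forall v, h0 v v = 0 -> v = 0) ->
  (forall i, psd_form sc (h i)) -> 0 < C -> 0 < t -> 0 < r -> S != finset.set0 ->
  (forall i, i \in S -> (#|S|%:R * r) ^+ 2 < gram_det (fun v w => C / 2 * h i v w) xs) ->
  gram_det (fun v w => (2 * t)^-1 * h0 v w) xs <= r ^+ 2 ->
  exists w, h0 w w = C * t /\ forall i, i \in S -> 1 <= h i w w.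
Proof.
move=> h0P h0_def hP C0 t0 r0 Sn0 det_h det_h0.
have S0 : 0 < #|S|%:R :> R by rewrite ltr0n card_gt0.
have d0 : 0 < gram_det (fun v w => (2 * t)^-1 * h0 v w) xs.
  apply: (@gram_det_gt0 _ _ sc); apply: psd_formZ => //.
  by rewrite invr_ge0 mulr_ge0// ltW.
apply: (@form_rounding _ _ xs) => //.
have rE : r^-1 = \sum_(i in S) (#|S|%:R * r)^-1.
  by rewrite sumr_const -[RHS]mulr_natl invfM mulrA divff ?mul1r// gt_eqF.
apply: (@lt_le_trans _ _ r^-1); last first.
  rewrite lef_pV2 ?posrE ?sqrtr_gt0//.
  by rewrite -[leRHS]ger0_norm ?(ltW r0)// -sqrtr_sqr ler_wsqrtr.
have /set0Pn[i0 Si0] := Sn0; rewrite rE; apply: ltr_sum.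
  by apply/hasP; exists i0 => //; rewrite mem_index_enum.
move=> i iS; have Sr0 : 0 < #|S|%:R * r by rewrite mulr_gt0.
have di := lt_trans (exprn_gt0 2 Sr0) (det_h i iS).
rewrite ltf_pV2 ?posrE ?sqrtr_gt0//.
by rewrite -[ltLHS]ger0_norm ?(ltW Sr0)// -sqrtr_sqr ltr_sqrt// det_h.
Qed.

Lemma expR1_le4 : expR 1 <= 4 :> R.
Proof.
have -> : expR 1 = expR 2^-1 ^+ 2 :> R by rewrite expr2 -expRD; congr expR; field.
have := expR_ge1Dx (- 2^-1 : R); have := expRxMexpNx_1 (2^-1 : R).
have := expR_gt0 (2^-1 : R); set x := expR _; set y := expR _ => x0 xy y_ge.
(* From [1 - 1/2 <= expR (- 1/2)], the inverse of [x]. *)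
have x2 : x <= 2 by nra.
rewrite -subr_ge0 (_ : _ - _ = (2 - x) * (2 + x)); last by ring.
by apply: mulr_ge0; lra.
Qed.

Lemma real_rounding (I : finType) (S : {set I}) xs h0 (h : I -> V -> V -> R) (C tau : R) :
  psd_form sc h0 -> (forall v, h0 v v = 0 -> v = 0) -> (forall i, psd_form sc (h i)) ->
  S != finset.set0 -> 0 < tau -> (forall i, i \in S -> tau <= \sum_(x <- xs) h i x x) ->
  4 * #|S|%:R ^+ 2 <= C * tau ->
  exists w, h0 w w = C * (\sum_(x <- xs) h0 x x) /\ forall i, i \in S -> 1 <= h i w w.
Proof.
move=> h0P h0_def hP Sn0 tau0 tau_le C_ge; have /set0Pn[i0 Si0] := Sn0.
have t0 := trace_gt0 h0P h0_def (hP i0) tau0 (tau_le i0 Si0).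
have S0 : 0 < #|S|%:R :> R by rewrite ltr0n card_gt0.
have C0 : 0 < C.
  by rewrite -(pmulr_lgt0 _ tau0) (lt_le_trans _ C_ge)// mulr_gt0// exprn_gt0.
(* The scaled [h0] has trace 1/2, so its determinant is at most [e <= 2 ^+ 2]; the others are at
   least [1 + C * tau], above [(2 * #|S|) ^+ 2]. *)
apply: (@det_rounding _ S xs _ _ _ _ 2) => //.
  move=> i iS; have hiP : psd_form sc (fun v w => C / 2 * h i v w).
    by apply: psd_formZ => //; rewrite divr_ge0// ltW.
  apply: lt_le_trans (gram_det_ge_trace xs hiP).
  rewrite -mulr_sumr; have := tau_le i iS; set s := \sum_(_ <- _) _ => le_s.
  have : C * tau <= C * s by rewrite ler_pM2l.
  by rewrite exprMn; lra.
have h0P' : psd_form sc (fun v w => (2 * \sum_(x <- xs) h0 x x)^-1 * h0 v w).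
  by apply: psd_formZ => //; rewrite invr_ge0 mulr_ge0// ltW.
apply: le_trans (gram_det_le_expR xs h0P') _; rewrite -mulr_sumr.
rewrite [X in expR X](_ : _ = 1); last by field; rewrite gt_eqF.
by apply: le_trans expR1_le4 _; lra.
Qed.

Lemma complex_rounding (J : V -> V) (I : finType) (S : {set I}) xs h0
    (h : I -> V -> V -> R) (C tau : R) :
  (forall v, J (J v) = - v) -> J_invariant J h0 -> (forall i, J_invariant J (h i)) ->
  psd_form sc h0 -> (forall v, h0 v v = 0 -> v = 0) -> (forall i, psd_form sc (h i)) ->
  S != finset.set0 -> 0 < tau -> (forall i, i \in S -> tau <= \sum_(x <- xs) h i x x) ->
  4 * #|S|%:R <= C * tau ->
  exists w, h0 w w = C * (\sum_(x <- xs) h0 x x) /\ forall i, i \in S -> 1 <= h i w w.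
Proof.
move=> JJ h0J hJ h0P h0_def hP Sn0 tau0 tau_le C_ge; have /set0Pn[i0 Si0] := Sn0.
have t0 := trace_gt0 h0P h0_def (hP i0) tau0 (tau_le i0 Si0).
have S0 : 0 < #|S|%:R :> R by rewrite ltr0n card_gt0.
have C0 : 0 < C by rewrite -(pmulr_lgt0 _ tau0) (lt_le_trans _ C_ge)// mulr_gt0.
(* Over [J_closure] the scaled [h0] has trace 1, so its determinant is at most [e ^+ 2 <= 4 ^+ 2].
   The others are at least [(1 + C * tau) ^+ 2]: this square is why [C] need only be linear in
   [#|S|]. *)
apply: (@det_rounding _ S (J_closure J xs) _ _ _ _ 4) => //.
  move=> i iS; have hiP : psd_form sc (fun v w => C / 2 * h i v w).
    by apply: psd_formZ => //; rewrite divr_ge0// ltW.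
  apply: lt_le_trans (gram_det_J_closure_ge JJ xs hiP _); last first.
    by move=> v w; rewrite hJ.
  rewrite -mulr_sumr; have := tau_le i iS; set s := \sum_(_ <- _) _ => le_s.
  have : C * tau <= C * s by rewrite ler_pM2l.
  by move=> le_Cs; rewrite ltr_pXn2r ?nnegrE//; lra.
have h0P' : psd_form sc (fun v w => (2 * \sum_(x <- xs) h0 x x)^-1 * h0 v w).
  by apply: psd_formZ => //; rewrite invr_ge0 mulr_ge0// ltW.
apply: le_trans (gram_det_le_expR (J_closure J xs) h0P') _; rewrite -mulr_sumr.
have -> : \sum_(x <- J_closure J xs) h0 x x = 2 * \sum_(x <- xs) h0 x x.
  rewrite /J_closure big_flatten big_map mulr_sumr; apply: eq_bigr => x _.
  by rewrite !big_cons big_nil h0J /= addr0 mulr_natl mulr2n.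
rewrite [X in expR X](_ : _ = 1 + 1); last by field; rewrite gt_eqF.
rewrite expRD -expr2; have := expR1_le4; have := expR_gt0 (1 : R); nra.
Qed.

End Rounding.

(** * Choice of the constraints to satisfy *)

Lemma large_weights (R : realType) (M Q : nat) (beta : 'I_M -> R) :
  (0 < Q)%N -> (Q <= M)%N -> \sum_i beta i = Q%:R -> (forall i, 0 <= beta i <= 1) ->
  exists2 S : {set 'I_M}, #|S| = Q &
    forall i, i \in S -> (M%:R - Q%:R + 1)^-1 <= beta i.
Proof.
move=> Q0 QM sumQ b01; set tau := (_ + 1)^-1.
have QMR : (Q%:R : R) <= M%:R by rewrite ler_nat.
have tau0 : 0 < tau by rewrite invr_gt0; lra.
pose T := [set i | tau <= beta i]; have [leQ|ltQ] := leqP Q #|T|.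
  exists [set i in take Q (enum T)] => [|i].
    rewrite cardsE; have /card_uniqP -> : uniq (take Q (enum T)).
      by rewrite take_uniq// enum_uniq.
    by rewrite size_take_min -cardE; apply/minn_idPl.
  by rewrite inE => /mem_take; rewrite mem_enum inE.
(* If only [k < Q] weights reach [tau], bounding these by 1 and the others strictly by [tau] gives a
   sum below [k + (M - k) * tau], which is at most [Q] since [(M - Q) * (Q - 1 - k) >= 0]. *)
suff : \sum_i beta i < Q%:R by rewrite sumQ ltxx.
have TM : (#|T| < M)%N by exact: leq_trans QM.
have kQ : (#|T|%:R : R) <= Q%:R - 1 by rewrite lerBrDr natr1 ler_nat.
rewrite (bigID [in T])/=; apply: (@lt_le_trans _ _ (#|T|%:R + (M%:R - #|T|%:R) * tau)).
  apply: ler_ltD.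
    rewrite -[#|T|]sum1_card natr_sum; apply: ler_sum => i _.
    by have /andP[] := b01 i.
  have -> : (M%:R - #|T|%:R : R) = \sum_(i | i \notin T) 1.
    have -> : M%:R = #|T|%:R + #|[predC T]|%:R :> R by rewrite -natrD cardC card_ord.
    by rewrite sumr_const addrAC subrr add0r.
  rewrite mulr_suml; apply: ltr_sum => [|i]; last by rewrite inE -ltNge mul1r.
  have /card_gt0P[i Ti] : (0 < #|~: T|)%N.
    by rewrite cardsCs finset.setCK card_ord subn_gt0.
  by apply/hasP; exists i; rewrite ?mem_index_enum//; rewrite finset.in_setC in Ti.
rewrite -lerBrDl ler_pdivrMr; last by lra.
rewrite -subr_ge0 [X in 0 <= X](_ : _ = (M%:R - Q%:R) * (Q%:R - 1 - #|T|%:R));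
  last by ring.
by apply: mulr_ge0; lra.
Qed.

(** * From matrices to real forms, and from rounding to optimal values *)

Section MatrixForms.
Context {R : realType} {F : numFieldType} (emb : {rmorphism R -> F})
  (cj : {rmorphism F -> F}) (re : {additive F -> R}).
Hypotheses (cjK : involutive cj) (mul_cj_ge0 : forall a, 0 <= a * cj a)
  (cj_emb : forall a, cj (emb a) = emb a)
  (emb_ge0 : forall a, 0 <= a -> 0 <= emb a)
  (re_cj : forall z, re (cj z) = re z)
  (re_embM : forall a z, re (emb a * z) = a * re z) (re1 : re 1 = 1)
  (re_ge0 : forall z, 0 <= z -> 0 <= re z)
  (emb_re : forall z, 0 <= z -> emb (re z) = z).
Local Notation adj := (adjmx cj).

Definition mx_form N (H : 'M[F]_N) (v w : 'cV[F]_N) : R :=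
  re ((adj v *m H *m w) 0 0).

Definition scale_emb N (a : R) (v : 'cV[F]_N) := emb a *: v.

Lemma psd_mx_form N (H : 'M[F]_N) :
  psdmx cj H -> psd_form (@scale_emb N) (mx_form H).
Proof.
move=> [Hh H_ge0]; rewrite /mx_form; split.
- move=> v w; rewrite -[LHS]re_cj.
  have <- : adj (adj v *m H *m w) = adj w *m H *m v.
    by rewrite !adjmxM adjmxK// Hh mulmxA.
  by rewrite 2![in RHS]mxE.
- by move=> u v w; rewrite adjmxD !mulmxDl mxE raddfD.
- by move=> a v w; rewrite /scale_emb adjmxZ cj_emb -!scalemxAl mxE re_embM.
- by move=> v; exact: re_ge0.
Qed.

Lemma adjmx_mul_selfE N (v : 'cV[F]_N) : (adj v *m v) 0 0 = \sum_j v j 0 * cj (v j 0).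
Proof. by rewrite mxE; apply: eq_bigr => j _; rewrite !mxE mulrC. Qed.

Lemma psdmx1 N : psdmx cj (1%:M : 'M[F]_N).
Proof.
split; first by rewrite /hermmx /adjmx map_mx1 trmx1.
by move=> v; rewrite mulmx1 adjmx_mul_selfE sumr_ge0.
Qed.

Lemma mx_form1_def N (v : 'cV[F]_N) : mx_form 1%:M v v = 0 -> v = 0.
Proof.
rewrite /mx_form mulmx1 => v0.
have : \sum_j v j 0 * cj (v j 0) = 0.
  by rewrite -adjmx_mul_selfE -[LHS]emb_re ?v0 ?rmorph0// adjmx_mul_selfE sumr_ge0.
move/eqP; rewrite psumr_eq0// => /allP v0'; apply/matrixP => j k; rewrite ord1 mxE.
have := v0' j (mem_index_enum j).
by rewrite /= mulf_eq0 fmorph_eq0 orbb => /eqP.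
Qed.

(** Every (SDP2) point of value [t] yields a (P1) point of value [C * t], so [vQP / C] is a lower
    bound of the (SDP2) values. An infeasible (SDP2) is included, its infimum being infinite. *)
Lemma vQP_le_vSDP2 N M Q (H : 'I_M -> 'M[F]_N) (C : R) :
  (0 < Q)%N -> (Q <= M)%N -> (forall i, psdmx cj (H i)) -> 0 < C ->
  (forall (xs : seq 'cV[F]_N) (S : {set 'I_M}), #|S| = Q ->
    (forall i, i \in S ->
       (M%:R - Q%:R + 1)^-1 <= \sum_(x <- xs) mx_form (H i) x x) ->
    exists w, mx_form 1%:M w w = C * (\sum_(x <- xs) mx_form 1%:M x x) /\
      forall i, i \in S -> 1 <= mx_form (H i) w w) ->
  (vQP emb cj Q H <= C%:E * vSDP2 emb cj Q H)%E.
Proof.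
move=> Q0 QM HP C0 round; rewrite -lee_pdivrMl//; apply: le_ereal_inf_tmp.
move=> _ [t [X [beta [[XP [b_le [sumQ b01]]] tE]]] <-].
rewrite lee_pdivrMl// -EFinM; apply: ereal_inf_lbound; exists (C * t) => //.
have re_emb a : re (emb a) = a by rewrite -[emb a]mulr1 re_embM re1 mulr1.
have cj_sqrt (a : F) : 0 <= a -> exists s, s * cj s = a.
  move=> a0; exists (emb (Num.sqrt (re a))).
  by rewrite cj_emb -rmorphM -expr2 sqr_sqrtr ?re_ge0// emb_re.
have [xs XE] := psdmx_rank_one_sum cjK cj_sqrt XP.
have trE G : re (\tr (G *m X)) = \sum_(x <- xs) mx_form G x x.
  by rewrite XE trace_rank_one_sum raddf_sum.
have [S cardS S_le] := large_weights Q0 QM sumQ b01.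
have [i iS|w [wE w_ge1]] := round xs S cardS.
  apply: le_trans (S_le i iS) _; rewrite -trE -subr_ge0 -[beta i]re_emb -raddfB.
  by rewrite re_ge0// subr_ge0.
have wP G : psdmx cj G -> emb (mx_form G w w) = (adj w *m G *m w) 0 0.
  by move=> [_ G_ge0]; rewrite /mx_form emb_re.
exists w, (fun i => i \in S); split; last first.
  have := wP _ (psdmx1 N); rewrite mulmx1 => <-; rewrite wE -trE mul1mx -tE re_emb//.
split=> [i|]; last first.
  by rewrite -cardS -sum1_card [RHS]big_mkcond/=; apply: eq_bigr => i _; case: (i \in S).
rewrite -wP// -subr_ge0 -(rmorph_nat emb) -rmorphB; apply: emb_ge0.
(* Outside [S] the constraint is only nonnegativity. *)
rewrite subr_ge0; case: (boolP (i \in S)) => [/w_ge1//|_].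
by apply: re_ge0; have [_] := HP i; exact.
Qed.

End MatrixForms.

(** * The real and the complex bounds *)

Local Open Scope ereal_scope.

Theorem theorem2p7 (R : realType) (N M Q : nat) :
  (2 <= N)%N -> (2 <= M)%N -> (1 <= Q)%N -> (Q <= M - 1)%N ->
  (forall H : 'I_M -> 'M[R]_N,
     (forall i, psdmx id (H i)) ->
     vQP id id Q H <=
      (27 * (Q%:R) ^+ 2 * (M%:R - Q%:R + 1) / pi)%R%:E * vSDP2 id id Q H) /\
  (forall H : 'I_M -> 'M[R[i]]_N,
     (forall i, psdmx (@conjc R) (H i)) ->
     vQP (@cplx_emb R) (@conjc R) Q H <=
      (Num.max (8 * Q%:R) (24 * (Num.sqrt (Q%:R : R) - 1) ^+ 2)
          * (M%:R - Q%:R + 1))%R%:E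
        * vSDP2 (@cplx_emb R) (@conjc R) Q H).
Proof.
move=> _ _ Q0 QM1; have QM : (Q <= M)%N by exact: leq_trans QM1 (leq_subr _ _).
have D0 : (0 < M%:R - Q%:R + 1 :> R)%R.
  by have : (Q%:R <= M%:R :> R)%R; [rewrite ler_nat|lra].
have QR : (0 < Q%:R :> R)%R by rewrite ltr0n.
have Sn0 (S : {set 'I_M}) : #|S| = Q -> S != finset.set0.
  by move=> SQ; rewrite -card_gt0 SQ.
split=> H HP.
  have p0 := pi_gt0 R; have p4 : (pi < 4 :> R)%R by have := pihalf_lt2 R; lra.
  have sq_ge0 (a : R) : (0 <= a * idfun a)%R by exact: sqr_ge0.
  have formP (G : 'M[R]_N) : psdmx id G ->
      psd_form (scale_emb idfun (N := N)) (mx_form idfun idfun G).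
    by move=> GP; apply: psd_mx_form.
  apply: (@vQP_le_vSDP2 R R idfun idfun idfun) => //.
  - by rewrite divr_gt0// mulr_gt0// mulr_gt0// exprn_gt0.
  move=> xs S SQ S_le; apply: (real_rounding (formP _ (psdmx1 sq_ge0 N)) _
    (fun i => formP _ (HP i)) (Sn0 S SQ) _ S_le).
  - exact: (mx_form1_def (emb := idfun)).
  - by rewrite invr_gt0.
  (* What remains is [4 * Q ^+ 2 * pi <= 27 * Q ^+ 2], for which [pi < 4] suffices. *)
  rewrite SQ mulrAC mulfK ?gt_eqF// ler_pdivlMr//.
  have : (0 <= Q%:R ^+ 2 :> R)%R by exact: sqr_ge0.
  by set q := (Q%:R ^+ 2)%R; nra.
have conj_ge0 (a : R[i]) : (0 <= a * conjc a)%R by exact: mulcJ_ge0.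
pose re : {additive R[i] -> R} := (@complex.Re R : {additive Rcomplex R -> R}).
have emb_re (z : R[i]) : (0 <= z)%R -> real_complex R (re z) = z.
  by move=> z0; apply: RRe_real; exact: ger0_real.
have re_ge0 (z : R[i]) : (0 <= z)%R -> (0 <= re z)%R.
  by rewrite lecE => /andP[].
have re_embM (a : R) (z : R[i]) : (re (real_complex R a * z) = a * re z)%R.
  by case: z => x y; rewrite /re /=; ring.
have re_cj (z : R[i]) : re (conjc z) = re z by case: z.
have formP (G : 'M[R[i]]_N) : psdmx (@conjc R) G ->
    psd_form (scale_emb (real_complex R) (N := N)) (mx_form (@conjc R) re G).
  by move=> GP; apply: psd_mx_form => //; [exact: conjcK|exact: conjc_real].
have formJ (G : 'M[R[i]]_N) :
    J_invariant (fun v : 'cV[R[i]]_N => 'i%C *: v) (mx_form (@conjc R) re G).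
  move=> v w; rewrite /mx_form adjmxZ -!scalemxAl -scalemxAr scalerA.
  have -> : (conjc 'i%C * 'i%C = 1 :> R[i])%R.
    apply/eqP; rewrite eq_complex /= !(mul0r, mulr0, mulN1r, mulr1, opprK).
    by rewrite !(subr0, add0r, addr0) !eqxx.
  by rewrite scale1r.
apply: (@vQP_le_vSDP2 R R[i] (real_complex R) (@conjc R) re) => //.
- exact: conjcK.
- exact: conjc_real.
- by move=> a; rewrite ler0c.
- by rewrite mulr_gt0// lt_max mulr_gt0.
move=> xs S SQ S_le; 
apply: (complex_rounding (J := fun v => 'i%C *: v) _ _ _
  (formP _ (psdmx1 conj_ge0 N)) _ (fun i => formP _ (HP i)) (Sn0 S SQ) _ S_le).
- by move=> v; rewrite scalerA -expr2 sqr_i scaleN1r.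
- exact: formJ.
- by move=> k; exact: formJ.
- exact: (mx_form1_def (emb := real_complex R)).
- by rewrite invr_gt0.
(* The rounding needs only [4 * Q], so the branch [8 * Q] of the maximum is enough. *)
rewrite SQ mulfK ?gt_eqF// le_max; apply/orP; left; lra.
Qed.
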